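(* Let $d=p_1p_2\cdots p_m$, where all the $p_i$ are distinct primes such that $p_1=2$ and all other primes are of the form $4r+1$. Then for any $x$-component of an integer solution $(x,y)$ of the Pell-like equation $x^2-dy^2=-1$, $2xd$ is a congruent number. Furthermore, if $x$ is itself a square, then $2d$ is also a congruent number.
   Context: A rational number $n$ is called a congruent number if there exist positive rational numbers $u,v,w$ with $u^2+v^2=w^2$ and $\frac{1}{2}uv=n$. Congruent numbers are not required to be square-free.
   Formalization: The formal theorem assumes x > 0 and x ≠ 1: for x < 0 the number 2xd is negative, hence not congruent, and x = 1 occurs only for d = 2, y = ±1, where 2xd = 2d = 4 is not a congruent number; no case in which the claim holds is lost. *)

(* Defs.v *)
From mathcomp Require Import all_boot all_order all_algebra.

Set Implicit Arguments.
Unset Strict Implicit.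
Unset Printing Implicit Defensive.

Import Order.TTheory GRing.Theory Num.Theory.
Local Open Scope ring_scope.

Definition congruent_number (n : rat) : Prop :=
  exists u v w : rat,
    [/\ 0 < u, 0 < v, 0 < w, u ^+ 2 + v ^+ 2 = w ^+ 2 & 2^-1 * (u * v) = n].

(* Main.v *)
Require Import Defs.
From mathcomp Require Import all_boot all_order all_algebra.
From mathcomp Require Import ring lra.

Set Implicit Arguments.
Unset Strict Implicit.
Unset Printing Implicit Defensive.

Import Order.TTheory GRing.Theory Num.Theory.
Local Open Scope ring_scope.

(** Adding and subtracting [2 x] in the Pell-like equation, written
    [d y^2 = x^2 + 1], gives [d y^2 + 2 x = (x + 1)^2] and
    [d y^2 - 2 x = (x - 1)^2].  Hence for [n = 2 x d] and [X = d^2 y^2] the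
    three numbers [X - n], [X], [X + n] are [d (x - 1)^2], [(d y)^2],
    [d (x + 1)^2], and their product is the square of
    [Y = d^2 y (x^2 - 1)].  So [(X, Y)] is a rational point on the congruent
    number curve [Y^2 = X^3 - n^2 X], and when [1 < x] it has [Y <> 0], so
    that it yields the right triangle of area [n] with sides
    [|X^2 - n^2| / |Y|], [2 n X / |Y|] and [(X^2 + n^2) / |Y|]
    ([pell_congruent]).  When [x = k^2], dividing the sides by [|k|] turns
    the area [2 x d] into [2 d] ([congruent_number_divX2]). *)

Lemma congruent_number_divX2 (n k : rat) :
  k != 0 -> congruent_number (n * k ^+ 2) -> congruent_number n.
Proof.
move=> k_neq0 [u [v [w [u_gt0 v_gt0 w_gt0 pyth area]]]].
have k_gt0 : 0 < `|k| by rewrite normr_gt0.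
exists (u / `|k|), (v / `|k|), (w / `|k|); split; try exact: divr_gt0.
  by rewrite !expr_div_n -mulrDl pyth.
rewrite -(mulfK (expf_neq0 2 k_neq0) n) -area -(real_normK (num_real k)).
by field; rewrite gt_eqF.
Qed.

(** The sides come from the point [X = d^2 y^2], [Y = d^2 y (x^2 - 1)] of
    [Y^2 = X^3 - (2 x d)^2 X], simplified by means of [d y^2 = x^2 + 1].
    The condition [1 < x] keeps the point away from the 2-torsion, where
    [Y = 0] and the triangle degenerates. *)
Lemma pell_congruent (x y d : rat) :
  1 < x -> x ^+ 2 - d * y ^+ 2 = -1 -> congruent_number (2 * x * d).
Proof.
move=> x_gt1 pell.
have dyE : d * `|y| ^+ 2 = x ^+ 2 + 1 by rewrite real_normK ?num_real //; lra.
have y_gt0 : 0 < `|y|.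
  rewrite normr_gt0; apply/eqP => y0; move: dyE.
  by rewrite y0 normr0; nra.
move: {y pell} `|y| y_gt0 dyE => y y_gt0 dyE.
have dE : d = (x ^+ 2 + 1) / y ^+ 2.
  by rewrite -dyE mulfK // expf_neq0 // gt_eqF.
have x2B1_gt0 : 0 < x ^+ 2 - 1 by nra.
have [y_neq0 x2B1_neq0] : y != 0 /\ x ^+ 2 - 1 != 0 by rewrite !gt_eqF.
have den_gt0 : 0 < y * (x ^+ 2 - 1) by rewrite mulr_gt0.
exists ((x ^+ 2 - 1) / y), (4 * x * (x ^+ 2 + 1) / (y * (x ^+ 2 - 1))),
  (((x ^+ 2 + 1) ^+ 2 + 4 * x ^+ 2) / (y * (x ^+ 2 - 1))).
split; try by apply: divr_gt0 => //; nra.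
  by field; apply/andP.
by rewrite dE; field; apply/andP.
Qed.

(* The primes p_1, ..., p_m are p ord0, ..., p ord_max, with m = m'.+1.
   The hypothesis 0 < x is needed because congruent numbers are positive; the
   hypothesis x <> 1 removes exactly the solutions (1, +-1), which occur only
   for d = 2 and for which 2xd = 2d = 4 is not a congruent number. *)
Theorem theorem4p11 (m' : nat) (p : 'I_m'.+1 -> nat) (d : nat)
    (p_prime : forall i : 'I_m'.+1, prime (p i))
    (p_distinct : injective p)
    (p1_eq2 : p ord0 = 2%N)
    (p_4r1 : forall i : 'I_m'.+1, i <> ord0 ->
       exists r : nat, p i = (4 * r + 1)%N)
    (d_def : d = (\prod_(i < m'.+1) p i)%N)
    (x y : int)
    (pell : x ^+ 2 - d%:Z * y ^+ 2 = -1)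
    (x_gt0 : 0 < x)
    (x_neq1 : x <> 1) :
  congruent_number (2 * x * d%:Z)%:~R /\
  ((exists k : int, x = k ^+ 2) -> congruent_number (2 * d)%:R).
Proof.
have x_gt1 : 1 < x%:~R :> rat.
  by rewrite ltr1z lt_neqAle eq_sym -gtz0_ge1 x_gt0 andbT; apply/eqP.
have pellQ : x%:~R ^+ 2 - d%:R * y%:~R ^+ 2 = -1 :> rat.
  by rewrite -[d%:R]/(d%:Z%:~R) -!rmorphXn -rmorphM -rmorphB /= pell rmorphN1.
have congr_2xd : congruent_number (2 * x * d%:Z)%:~R.
  by rewrite !rmorphM; apply: pell_congruent pellQ.
split=> // -[k xE].
have k_neq0 : k%:~R != 0 :> rat.
  by rewrite intr_eq0; apply/eqP => k0; move: x_gt0; rewrite xE k0.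
apply: (congruent_number_divX2 k_neq0).
move: congr_2xd; rewrite xE 2!rmorphM rmorphXn natrM /=.
by rewrite mulrAC.
Qed.
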